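(* Let $e$ be an interior edge of a triangular mesh separating cells $K$ and $L$, fix $\Delta t>0$ and fix the discrete data at time $t_n$ (distribution functions $f_K^n,f_L^n$, positive macroscopic states, vertex values, bounded opacities). In the first-order UGKS on unstructured meshes, define the normal half slopes of the macroscopic state by $$\delta_n^-\mathbf{W}_e^n=\frac{\mathbf{W}_e^n-\mathbf{W}_K^n}{h^-}-\kappa\frac{\mathbf{W}_e^{n,+}-\mathbf{W}_e^{n,-}}{|e|},\qquad \delta_n^+\mathbf{W}_e^n=\frac{\mathbf{W}_L^n-\mathbf{W}_e^n}{h^+}-\kappa\frac{\mathbf{W}_e^{n,+}-\mathbf{W}_e^{n,-}}{|e|},$$ and the interface state by $$\mathbf{W}_e^n=-\frac{h^+-h^-}{2h}(\mathbf{W}_L^n-\mathbf{W}_K^n)+\frac12(\mathbf{W}_K^n+\mathbf{W}_L^n).$$ Then the consistency property $$\frac12\left(\delta_n^-\mathbf{W}_e^n+\delta_n^+\mathbf{W}_e^n\right)=\frac{\mathbf{W}_L^n-\mathbf{W}_K^n}{h}-\kappa\frac{\mathbf{W}_e^{n,+}-\mathbf{W}_e^{n,-}}{|e|}$$ holds, and, with $\eta=\epsilon$ and $\epsilon\to0$, the macroscopic fluxes converge to those of the diamond scheme for the diffusion system: $$\Phi^\rho_{K,e}\longrightarrow-\frac{2}{3\sigma_e^n}\left(\frac{q_L^n-q_K^n}{h}-\kappa\frac{q_e^{n,+}-q_e^{n,-}}{|e|}\right),$$ $$\Phi^q_{K,e}\longrightarrow-\frac{2}{3\sigma_e^n}\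frac{5(q_e^n)^2}{3\rho_e^n}\left[-\frac{1}{\rho_e^n}\left(\frac{\rho_L^n-\rho_K^n}{h}-\kappa\frac{\rho_e^{n,+}-\rho_e^{n,-}}{|e|}\right)+\frac{2}{q_e^n}\left(\frac{q_L^n-q_K^n}{h}-\kappa\frac{q_e^{n,+}-q_e^{n,-}}{|e|}\right)\right].$$
   Context: Notation: $\mathbb{S}^2$ is the unit sphere of $\mathbb{R}^3$, $v\in\mathbb{R}_+$ the speed, $\boldsymbol\Omega\in\mathbb{S}^2$ the direction; $\langle\langle g\rangle\rangle=\int_{\mathbb{S}^2}\int_{\mathbb{R}_+}g\,v^2\,dv\,d\Omega$; $\boldsymbol\Psi(v)=(1,\frac12v^2)^T$. The electron transport equation is $\partial_t f+\frac{v}{\eta}\boldsymbol\Omega\cdot\nabla_{\mathbf{x}}f=\nu(M[f]-f)$ with $\nu=\frac{\sigma}{\epsilon\eta}$, where $\sigma=C\rho/T^{3/2}$ ($C>0$ constant) is the opacity, $q=\frac32\rho T$, $\mathbf{W}=(\rho,q)^T=\langle\langle\boldsymbol\Psi f\rangle\rangle$ and $M[\mathbf{W}](v)=\frac{\rho}{(2\pi T)^{3/2}}e^{-v^2/(2T)}$. The limit diffusion system is $\partial_t\rho=\nabla_{\mathbf{x}}\cdot\left(\frac{2}{3\sigma}\nabla_{\mathbf{x}}q\right)$, $\partial_t q=\nabla_{\mathbf{x}}\cdot\left(\frac53\frac{2}{3\sigma}\nabla_{\mathbf{x}}\frac{q^2}{\rho}\right)$. Geometry: $\mathbf{x}_K,\mathbf{x}_L$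 are the centers of mass of $K,L$; $\mathbf{n}_{K,e}$ is the unit normal to $e$ pointing out of $K$, $\boldsymbol\tau_{K,e}$ the unit tangent such that $(\mathbf{n}_{K,e},\boldsymbol\tau_{K,e})$ is a direct basis; $\mathbf{x}_e^\pm$ are the end points of $e$, with $(\mathbf{x}_e^+-\mathbf{x}_e^-)\cdot\boldsymbol\tau_{K,e}>0$, and $|e|$ is its length; $\mathbf{x}_e^*$ is the intersection of $e$ with the line through $\mathbf{x}_K$ and $\mathbf{x}_L$. Set $h=(\mathbf{x}_L-\mathbf{x}_K)\cdot\mathbf{n}_{K,e}$, $h^-=(\mathbf{x}_e^*-\mathbf{x}_K)\cdot\mathbf{n}_{K,e}>0$, $h^+=(\mathbf{x}_L-\mathbf{x}_e^* )\cdot\mathbf{n}_{K,e}>0$, and $\kappa=\frac{(\mathbf{x}_L-\mathbf{x}_K)\cdot\boldsymbol\tau_{K,e}}{(\mathbf{x}_L-\mathbf{x}_K)\cdot\mathbf{n}_{K,e}}$. $\mathbf{W}_K^n=(\rho_K^n,q_K^n)^T$ is the cell state, $\mathbf{W}_e^n=(\rho_e^n,q_e^n)^T$ the interface state, and $\mathbf{W}_e^{n,\pm}=(\rho_e^{n,\pm},q_e^{n,\pm})^T$ are values at the vertices $\mathbf{x}_e^\pm$, obtained from cell values by least squares: for a vertex $\mathbf{x}_V$, each component is the constant $a$ of the affine function $a+\mathbf{b}\cdot(\mathbf{x}-\mathbf{x}_V)$ that minimizes the sum, over cells having $\mathbf{x}_V$ as vertex, of the squared differences between its value at the cell center and the cell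 value. $\sigma_e^n=\frac12(\sigma_K^n+\sigma_L^n)>0$. The microscopic flux of first-order UGKS (tangential Maxwellian slopes neglected), with $\Omega_n=\boldsymbol\Omega\cdot\mathbf{n}_{K,e}$, is $$\phi_{K,e}=A\,v\Omega_n\big(f_K^n\mathbb{1}_{\Omega_n>0}+f_L^n\mathbb{1}_{\Omega_n<0}\big)+C_0\,v\Omega_nM[\mathbf{W}_e^n]+D\,v^2\Omega_n^2\big(\delta_n^-M_e^n\mathbb{1}_{\Omega_n>0}+\delta_n^+M_e^n\mathbb{1}_{\Omega_n<0}\big),$$ where $\delta_n^\pm M_e^n=\boldsymbol\Psi^T\mathbf{K}(\mathbf{W}_e^n)\,\delta_n^\pm\mathbf{W}_e^n$, $$\mathbf{K}(\mathbf{W})=M[\mathbf{W}]\begin{pmatrix}\frac{5}{2\rho}&-\frac{3}{2q}\\-\frac{3}{2q}&\frac{3\rho}{2q^2}\end{pmatrix},$$ and, with $w=-\frac{\sigma_e^n}{\epsilon\eta}\Delta t$, $$A=-\frac1\eta\frac{1-e^w}{w},\quad C_0=\frac1\eta\Big(1+\frac{1-e^w}{w}\Big),\quad D=-\frac{\epsilon}{\sigma_e^n\eta}\Big(1+e^w+2\frac{1-e^w}{w}\Big).$$ The macroscopic fluxes are $(\Phi^\rho_{K,e},\Phi^q_{K,e})^T=\langle\langle\boldsymbol\Psi\,\phi_{K,e}\rangle\rangle$; the velocity moments of $f_K^n,f_L^n$ appearing in them are assumed finite. *)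

(* Defs.v *)
From HB Require Import structures.
From mathcomp Require Import all_boot all_order all_algebra.
From mathcomp Require Import all_classical all_reals all_analysis.

Set Implicit Arguments.
Unset Strict Implicit.
Unset Printing Implicit Defensive.

Import Order.TTheory GRing.Theory Num.Theory.
Import numFieldNormedType.Exports.

Local Open Scope classical_set_scope.
Local Open Scope ring_scope.

Section Plane.
Variable R : realType.

Definition dot (d : nat) (x y : 'rV[R]_d) : R := \sum_(i < d) x 0 i * y 0 i.

(* The Euclidean norm; `|x| is the sup norm on 'rV[R]_d. *)
Definition enorm (d : nat) (x : 'rV[R]_d) : R := Num.sqrt (dot x x).

(* x /\ y > 0 iff (x, y) is a direct basis of the plane. *)
Definition cross (x y : 'rV[R]_2) : R := \det (col_mx x y : 'M[R]_2).

Definition line (x y : 'rV[R]_2) : set 'rV[R]_2 :=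
  [set z | exists t : R, z = x + t *: (y - x)].

Definition convex_hull (V : finType) (pos : V -> 'rV[R]_2) (S : {set V}) :
    set 'rV[R]_2 :=
  [set x | exists w : V -> R, [/\ forall v, v \in S -> 0 <= w v,
     \sum_(v in S) w v = 1 & x = \sum_(v in S) w v *: pos v]].

End Plane.

(* A conforming triangular mesh of a polygonal domain of the plane. A cell is
   the set of its three vertices, an edge the set of its two end points, and
   the corresponding closed triangles and segments are the convex hulls. Cell
   data are functions on {set V}, only their values on cells being relevant. *)
Record trimesh (R : realType) (V : finType) := TriMesh {
  pos : V -> 'rV[R]_2;
  cells : {set {set V}};
  cell_card : forall K, K \in cells -> #|K| = 3%N;
  cell_nondegenerate : forall K a b c, K \in cells -> K = [set a; b; c]%SET ->
    cross (pos b - pos a) (pos c - pos a) != 0;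
  cell_conforming : forall K L, K \in cells -> L \in cells ->
    convex_hull pos K `&` convex_hull pos L = convex_hull pos (K :&: L)
}.

Section Mesh.
Variables (R : realType) (V : finType) (Th : trimesh R V).

(* The center of mass of a triangle is the mean of its three vertices. *)
Definition barycenter (K : {set V}) : 'rV[R]_2 :=
  3^-1 *: \sum_(v in K) pos Th v.

Definition separates (e K L : {set V}) : Prop :=
  [/\ K \in cells Th, L \in cells Th, K != L, e = K :&: L & #|e| = 2%N].

Definition outward_normal (K e : {set V}) (n : 'rV[R]_2) : Prop :=
  [/\ enorm n = 1,
      forall x y, x \in e -> y \in e -> dot (pos Th y - pos Th x) n = 0
    & forall x c, x \in e -> c \in K :\: e -> dot (pos Th c - pos Th x) n < 0].

(* tau is the unit tangent to the edge with (n, tau) a direct basis. *)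
Definition direct_tangent (e : {set V}) (n tau : 'rV[R]_2) : Prop :=
  [/\ enorm tau = 1,
      forall x y, x \in e -> y \in e ->
        exists t, pos Th y - pos Th x = t *: tau
    & 0 < cross n tau].

(* xm and xp are the end points x_e^- and x_e^+ of e. *)
Definition end_points (e : {set V}) (tau : 'rV[R]_2) (xm xp : V) : Prop :=
  e = [set xm; xp]%SET /\ 0 < dot (pos Th xp - pos Th xm) tau.

Definition lsq_residual (u : {set V} -> R) (x : V) (a : R) (b : 'rV[R]_2) : R :=
  \sum_(K in cells Th | x \in K)
    (a + dot b (barycenter K - pos Th x) - u K) ^+ 2.

(* a is the constant term of an affine function minimizing the residual. The
   minimizer need not be unique (e.g. at a vertex with fewer than three cells),
   in which case any of them is allowed. *)
Definition lsq_vertex_value (u : {set V} -> R) (x : V) (a : R) : Prop :=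
  exists b, forall a' b', lsq_residual u x a b <= lsq_residual u x a' b'.

End Mesh.

Section Macroscopic.
Variable R : realType.

Definition vec2 (a b : R) : 'cV[R]_2 :=
  \col_(i < 2) if i == 0 then a else b.

Definition mat2 (a b c d : R) : 'M[R]_2 :=
  \matrix_(i < 2, j < 2)
    if i == 0 then (if j == 0 then a else b) else (if j == 0 then c else d).

(* A macroscopic state is the column W = (rho, q)^T. *)
Definition rho (W : 'cV[R]_2) : R := W 0 0.
Definition q (W : 'cV[R]_2) : R := W 1 0.

(* q = 3/2 rho T *)
Definition temperature (W : 'cV[R]_2) : R := 2 * q W / (3 * rho W).

Definition opacity (C : R) (W : 'cV[R]_2) : R :=
  C * rho W / temperature W `^ (3 / 2).

Definition maxwellian (W : 'cV[R]_2) (v : R) : R :=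
  rho W / (2 * pi * temperature W) `^ (3 / 2)
    * expR (- v ^+ 2 / (2 * temperature W)).

Definition Psi (v : R) : 'cV[R]_2 := vec2 1 (v ^+ 2 / 2).

Definition Kmx (W : 'cV[R]_2) (v : R) : 'M[R]_2 :=
  maxwellian W v *: mat2
    (5 / (2 * rho W))     (- (3 / (2 * q W)))
    (- (3 / (2 * q W)))   (3 * rho W / (2 * q W ^+ 2)).

(* The slope of the Maxwellian M[W] associated with a slope dW of W. *)
Definition maxwellian_slope (W dW : 'cV[R]_2) (v : R) : R :=
  ((Psi v)^T *m Kmx W v *m dW) 0 0.

(* Equal to W_e^n for W1 = W_K^n, W2 = W_L^n. *)
Definition interface_state (hm hp h : R) (W1 W2 : 'cV[R]_2) : 'cV[R]_2 :=
  - ((hp - hm) / (2 * h)) *: (W2 - W1) + 2^-1 *: (W1 + W2).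

(* delta_n^- W_e and delta_n^+ W_e are half_slope h^- kappa |e| W_K W_e W_e^-
   W_e^+ and half_slope h^+ kappa |e| W_e W_L W_e^- W_e^+. *)
Definition half_slope (hpm kappa len : R) (W1 W2 Wm Wp : 'cV[R]_2) :
    'cV[R]_2 :=
  hpm^-1 *: (W2 - W1) - (kappa / len) *: (Wp - Wm).

End Macroscopic.

Section Bracket.
Variable R : realType.

(* The point of the unit sphere S^2 with colatitude theta and longitude phi. *)
Definition direction (theta phi : R) : 'rV[R]_3 :=
  \row_(i < 3) if i == 0 then sin theta * cos phi
               else if i == 1 then sin theta * sin phi else cos theta.

(* Spherical coordinates ((theta, phi), v) of the velocity space S^2 x R_+. *)
Definition velocity_domain : set ((R * R) * R) :=
  (`[0, pi] `*` `[0, 2 * pi]) `*` `[0, +oo[.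

Definition velocity_measure :=
  ((@lebesgue_measure R \x @lebesgue_measure R) \x @lebesgue_measure R)%E.

(* g(Omega, v) v^2 dv dOmega in spherical coordinates, where
   dOmega = sin(theta) dtheta dphi. *)
Definition bracket_integrand (g : 'rV[R]_3 -> R -> R) (x : (R * R) * R) : R :=
  g (direction x.1.1 x.1.2) x.2 * x.2 ^+ 2 * sin x.1.1.

Definition bracket (g : 'rV[R]_3 -> R -> R) : R :=
  \int[velocity_measure]_(x in velocity_domain) bracket_integrand g x.

Definition finite_bracket (g : 'rV[R]_3 -> R -> R) : Prop :=
  velocity_measure.-integrable velocity_domain (EFin \o bracket_integrand g).

End Bracket.

Section Flux.
Variable R : realType.
Implicit Types (eps eta dt sigma v : R) (n : 'rV[R]_2) (Om : 'rV[R]_3)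
  (fK fL : 'rV[R]_3 -> R -> R) (We dWm dWp : 'cV[R]_2).

(* Omega . n, the plane of the mesh being the plane x_3 = 0 of R^3. *)
Definition Omega_n n Om : R := dot Om (row_mx n (0 : 'rV[R]_1) : 'rV[R]_3).

Definition relaxation eps eta dt sigma : R := - (sigma / (eps * eta)) * dt.

Definition coefA eps eta dt sigma : R :=
  let w := relaxation eps eta dt sigma in
  - eta^-1 * ((1 - expR w) / w).

Definition coefC eps eta dt sigma : R :=
  let w := relaxation eps eta dt sigma in
  eta^-1 * (1 + (1 - expR w) / w).

Definition coefD eps eta dt sigma : R :=
  let w := relaxation eps eta dt sigma in
  - (eps / (sigma * eta)) * (1 + expR w + 2 * ((1 - expR w) / w)).

(* v Omega_n (fK 1_{Omega_n > 0} + fL 1_{Omega_n < 0}) *)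
Definition upwind_flux n fK fL Om v : R :=
  v * Omega_n n Om *
    (fK Om v * (0 < Omega_n n Om)%R%:R + fL Om v * (Omega_n n Om < 0)%R%:R).

(* dWm and dWp are the half slopes delta_n^- W_e and delta_n^+ W_e. *)
Definition micro_flux eps eta dt sigma n fK fL We dWm dWp Om v : R :=
  coefA eps eta dt sigma * upwind_flux n fK fL Om v
  + coefC eps eta dt sigma * (v * Omega_n n Om * maxwellian We v)
  + coefD eps eta dt sigma * (v ^+ 2 * Omega_n n Om ^+ 2 *
      (maxwellian_slope We dWm v * (0 < Omega_n n Om)%R%:R
       + maxwellian_slope We dWp v * (Omega_n n Om < 0)%R%:R)).

(* (Phi^rho, Phi^q)^T = << Psi phi >> *)
Definition macro_flux eps eta dt sigma n fK fL We dWm dWp : 'cV[R]_2 :=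
  \col_(i < 2) bracket (fun Om v =>
    Psi v i 0 * micro_flux eps eta dt sigma n fK fL We dWm dWp Om v).

End Flux.

(* Main.v *)
Require Import Defs.
From HB Require Import structures.
From mathcomp Require Import all_boot all_order all_algebra.
From mathcomp Require Import ring lra.
From mathcomp Require Import all_classical all_reals all_analysis.
From mathcomp Require Import measurable_realfun.

Import Order.TTheory GRing.Theory Num.Theory.
Import numFieldNormedType.Exports.

Local Open Scope classical_set_scope.
Local Open Scope ring_scope.

(** The limit is read off the three terms of the microscopic flux once their
    moments are known.

    In spherical coordinates the integrands are products of a function of the
    colatitude, one of the longitude and one of the speed, because Omega . n is
    sin theta times a combination of cos phi and sin phi [Omega_nE]; brackets are
    therefore products of three one-dimensional integrals [bracket_tensor].
    Write the flux as A times an upwind part, C_0 times an equilibrium part and D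
    times a slope part.  For eta = eps, w = - sigma dt / eps^2 tends to minus
    infinity.  The upwind part has finite moments that do not depend on eps and A
    tends to 0 [cvg_coefA].  C_0 blows up like 1 / eps, but the equilibrium is
    isotropic, so its flux vanishes exactly [bracket_equilibrium].  What remains is
    the slope part, with D tending to - 1 / sigma [cvg_coefD].

    The slope part is a sum over the half spheres where Omega . n is positive or
    negative.  Both have the same second moment 2 pi / 3 along n
    [bracket_half_space], so the two half slopes only enter through their sum,
    that is, by the consistency property [mean_half_slope], through twice the
    diamond-scheme gradient.  The radial integrals are Gaussian moments of orders
    4, 6 and 8, computed from the order 0 by integration by parts
    [gauss_mon_rec]; inserting T = 2 q / (3 rho) gives the coefficients of the
    diffusion fluxes [slope_moment_rho, slope_moment_q].

    Positivity of the interface state, needed for its Maxwellian and its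
    temperature, comes from the mesh: the interface state is a convex combination
    of the cell states as soon as h^- and h^+ are positive, which follows from the
    two triangles lying on different sides of their common edge
    [opposite_sides, edge_distances_gt0]. *)

(** * Integrals of real functions *)

Lemma is_derive_continuous {R : realType} (F f : R -> R) :
  (forall x : R, is_derive x 1 F (f x)) -> continuous F.
Proof.
move=> dF x; apply: differentiable_continuous; apply/derivable1_diffP.
exact: ex_derive.
Qed.

Lemma Rintegral_primitive {R : realType} {F f : R -> R} {a b : R} :
  a < b -> (forall x : R, is_derive x 1 F (f x)) -> continuous f ->
  \int[lebesgue_measure]_(x in `[a, b]) f x = F b - F a.
Proof.
move=> ab dF cf; have cF := @is_derive_continuous _ _ _ dF.
rewrite /Rintegral (@continuous_FTC2 _ f F a b) //.
- exact: continuous_subspaceT.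
- split.
  + by move=> x _; exact: ex_derive.
  + by apply: cvg_at_right_filter; exact: cF.
  + by apply: cvg_at_left_filter; exact: cF.
- by move=> x _; rewrite derive1E derive_val.
Qed.

Lemma continuous_integrable_cc {R : realType} {f : R -> R} (cf : continuous f) (a b : R) :
  lebesgue_measure.-integrable `[a, b] (EFin \o f).
Proof.
apply: continuous_compact_integrable; first exact: segment_compact.
exact: continuous_subspaceT.
Qed.

(** Only the derivative of the translation, the constant 1, enters the change of
    variables. *)
Lemma Rintegral_shift {R : realType} (f : R -> R) (a b c : R) :
  a <= b -> continuous f ->
  \int[lebesgue_measure]_(x in `[a + c, b + c]) f x =
  \int[lebesgue_measure]_(x in `[a, b]) f (x + c).
Proof.
move=> ab cf; rewrite /Rintegral; congr fine.
have d1 : derive1 (fun x : R => x + c) = cst 1.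
  by apply/funext => x; rewrite derive1E derive_val addr0.
rewrite (@integration_by_substitution_increasing _ (fun x => x + c)) //.
- by apply: eq_integral => x _ /=; rewrite d1 /= mulr1.
- by move=> x y _ _; rewrite ltrD2r.
- by rewrite d1 => x _; exact: cvg_cst.
- by rewrite d1; exact: is_cvg_cst.
- by rewrite d1; exact: is_cvg_cst.
- have cF : continuous (fun x : R => x + c).
    by move=> x; apply: cvgD; [exact: cvg_id|exact: cvg_cst].
  split.
  + by move=> x _; exact: ex_derive.
  + by apply: cvg_at_right_filter; exact: cF.
  + by apply: cvg_at_left_filter; exact: cF.
- exact: continuous_subspaceT.
Qed.

Lemma integrable_scale {d} {S : measurableType d} {R : realType}
    {mu : {measure set S -> \bar R}} {D : set S} (k : R) {f : S -> R} :
  measurable D -> mu.-integrable D (EFin \o f) ->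
  mu.-integrable D (EFin \o (fun x => k * f x)).
Proof.
move=> mD fi; rewrite (_ : _ \o _ = fun x => (k%:E * (EFin \o f) x)%E).
  exact: integrableZl.
by apply/funext => x /=; rewrite EFinM.
Qed.

Lemma integrable_add {d} {S : measurableType d} {R : realType}
    {mu : {measure set S -> \bar R}} {D : set S} {f g : S -> R} :
  measurable D -> mu.-integrable D (EFin \o f) -> mu.-integrable D (EFin \o g) ->
  mu.-integrable D (EFin \o (fun x => f x + g x)).
Proof.
move=> mD fi gi; rewrite (_ : _ \o _ = (EFin \o f) \+ (EFin \o g))%E //.
exact: integrableD.
Qed.

(** * Integrals of products over product spaces *)

Section ProductIntegral.
Context {d1 d2 : measure_display} {T1 : measurableType d1}
  {T2 : measurableType d2} {R : realType}.
Context (m1 : {sigma_finite_measure set T1 -> \bar R})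
  (m2 : {sigma_finite_measure set T2 -> \bar R}).
Implicit Types (A : set T1) (B : set T2) (f : T1 -> R) (g : T2 -> R).

Local Notation mprod := (m1 \x m2)%E.

(** By Tonelli, the integral of the absolute value is the product of those of the
    factors. *)
Lemma integrable_tensorT f g :
  m1.-integrable setT (EFin \o f) -> m2.-integrable setT (EFin \o g) ->
  mprod.-integrable setT (fun x => (f x.1 * g x.2)%:E).
Proof.
move=> fi gi.
have mf : measurable_fun setT f by apply/measurable_EFinP; exact: measurable_int fi.
have mg : measurable_fun setT g by apply/measurable_EFinP; exact: measurable_int gi.
apply/integrable12ltyP.
  apply/measurable_EFinP; apply: measurable_funM.
    exact: measurableT_comp mf measurable_fst.
  exact: measurableT_comp mg measurable_snd.
have [c cE] : exists c : R, (\int[m2]_y `|(g y)%:E| = c%:E)%E.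
  have /integrableP[_ gy] := gi; exists (fine (\int[m2]_y `|(g y)%:E|)%E).
  by rewrite fineK // ge0_fin_numE //; exact: integral_ge0.
have c0 : 0 <= c by rewrite -lee_fin -cE; exact: integral_ge0.
have inner x : (\int[m2]_y `|(f x * g y)%:E| = c%:E * `|(f x)%:E|)%E.
  under eq_integral do rewrite EFinM abseM.
  rewrite ge0_integralZl // ?cE; first by rewrite muleC.
  by apply: measurableT_comp => //; exact/measurable_EFinP.
under eq_integral do rewrite inner.
have /integrableP[_ fy] := fi.
rewrite ge0_integralZl ?lee_fin //.
  by rewrite lte_mul_pinfty ?lee_fin.
by apply: measurableT_comp => //; exact/measurable_EFinP.
Qed.

Lemma Rintegral_tensorT f g :
  m1.-integrable setT (EFin \o f) -> m2.-integrable setT (EFin \o g) ->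
  \int[mprod]_(x in setT) (f x.1 * g x.2) =
  \int[m1]_(x in setT) f x * \int[m2]_(y in setT) g y.
Proof.
move=> fi gi; rewrite {1}/Rintegral.
rewrite -(integral12_prod_meas1 (integrable_tensorT _ _ fi gi)) /fubini_F /=.
have inner x : (\int[m2]_y (f x * g y)%:E = (f x)%:E * \int[m2]_y (g y)%:E)%E.
  by under eq_integral do rewrite EFinM; rewrite integralZl.
under eq_integral do rewrite inner.
have [c cE] : exists c : R, (\int[m2]_y (g y)%:E = c%:E)%E.
  exists (fine (\int[m2]_y (g y)%:E)%E); rewrite fineK //.
  exact: (integrable_fin_num measurableT gi).
rewrite cE integralZr // fineM //; first by rewrite /Rintegral cE.
exact: (integrable_fin_num measurableT fi).
Qed.

Let tensor_patch A B f g :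
  (fun x => f x.1 * g x.2) \_ (A `*` B) =
  (fun x => (f \_ A) x.1 * (g \_ B) x.2).
Proof.
apply/funext => -[x y]; rewrite !patchE /= in_setX /=.
by case: (x \in A); case: (y \in B); rewrite /= ?mulr0 ?mul0r.
Qed.

Lemma integrable_tensor A B f g : measurable A -> measurable B ->
  m1.-integrable A (EFin \o f) -> m2.-integrable B (EFin \o g) ->
  mprod.-integrable (A `*` B) (fun x => (f x.1 * g x.2)%:E).
Proof.
move=> mA mB /(integrable_mkcond _ mA) fi /(integrable_mkcond _ mB) gi.
apply/(integrable_mkcond _ (measurableX mA mB)).
rewrite (restrict_EFin (fun x => f x.1 * g x.2)) tensor_patch.
by apply: integrable_tensorT; rewrite -restrict_EFin.
Qed.

Lemma Rintegral_tensor A B f g : measurable A -> measurable B ->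
  m1.-integrable A (EFin \o f) -> m2.-integrable B (EFin \o g) ->
  \int[mprod]_(x in A `*` B) (f x.1 * g x.2) =
  \int[m1]_(x in A) f x * \int[m2]_(y in B) g y.
Proof.
move=> mA mB /(integrable_mkcond _ mA) fi /(integrable_mkcond _ mB) gi.
rewrite Rintegral_mkcond tensor_patch Rintegral_tensorT -?Rintegral_mkcond //.
- by rewrite -restrict_EFin.
- by rewrite -restrict_EFin.
Qed.

End ProductIntegral.

Section SigmaFiniteProduct.
Context {d1 d2 : measure_display} {T1 : measurableType d1}
  {T2 : measurableType d2} {R : realType}.
Context (m1 : {sigma_finite_measure set T1 -> \bar R})
  (m2 : {sigma_finite_measure set T2 -> \bar R}).

(** A name for the product measure which carries its sigma-finite structure, so that
    Fubini can be applied again to a product with a third measure. *)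
Definition sigma_finite_prod : set (T1 * T2) -> \bar R := (m1 \x m2)%E.

HB.instance Definition _ := Measure.on sigma_finite_prod.

Let sigma_finite_prodT : sigma_finite setT sigma_finite_prod.
Proof.
have /sigma_finiteP[F [UF ndF finF]] := sigma_finiteT m1.
have /sigma_finiteP[G [UG ndG finG]] := sigma_finiteT m2.
exists (fun n => F n `*` G n).
  apply/seteqP; split=> // -[x y] _.
  have [i _ Fx] : (\bigcup_i F i) x by rewrite -UF.
  have [j _ Gy] : (\bigcup_i G i) y by rewrite -UG.
  exists (maxn i j) => //; split=> /=.
    by have /subsetPset := ndF _ _ (leq_maxl i j); exact.
  by have /subsetPset := ndG _ _ (leq_maxr i j); exact.
move=> n; have [mF Foo] := finF n; have [mG Goo] := finG n.
split; first exact: measurableX.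
rewrite [ltLHS](_ : _ = m1 (F n) * m2 (G n))%E; last exact: product_measure1E.
by rewrite lte_mul_pinfty // ge0_fin_numE.
Qed.

HB.instance Definition _ :=
  Measure_isSigmaFinite.Build _ _ _ sigma_finite_prod sigma_finite_prodT.

End SigmaFiniteProduct.

(** Fubini, applied twice: the velocity space is parameterized by two angles and a
    speed, and every integrand below is a product of functions of one of them. *)
Lemma tensor3 {d1 d2 d3 : measure_display} {T1 : measurableType d1}
    {T2 : measurableType d2} {T3 : measurableType d3} {R : realType}
    {m1 : {sigma_finite_measure set T1 -> \bar R}}
    {m2 : {sigma_finite_measure set T2 -> \bar R}}
    {m3 : {sigma_finite_measure set T3 -> \bar R}}
    {A : set T1} {B : set T2} {C : set T3}
    {f : T1 -> R} {g : T2 -> R} {h : T3 -> R} :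
  measurable A -> measurable B -> measurable C ->
  m1.-integrable A (EFin \o f) -> m2.-integrable B (EFin \o g) ->
  m3.-integrable C (EFin \o h) ->
  ((m1 \x m2) \x m3)%E.-integrable ((A `*` B) `*` C)
    (fun x => (f x.1.1 * g x.1.2 * h x.2)%:E) /\
  \int[((m1 \x m2) \x m3)%E]_(x in (A `*` B) `*` C)
    (f x.1.1 * g x.1.2 * h x.2) =
  (\int[m1]_(x in A) f x) * (\int[m2]_(x in B) g x) * (\int[m3]_(x in C) h x).
Proof.
move=> mA mB mC fi gi hi.
have mAB := measurableX mA mB.
have fgi := integrable_tensor m1 m2 A B f g mA mB fi gi.
pose m12 : {sigma_finite_measure set (T1 * T2)%type -> \bar R} :=
  sigma_finite_prod m1 m2.
split.
  exact: (integrable_tensor m12 m3 _ C _ h mAB mC fgi hi).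
rewrite [LHS](Rintegral_tensor m12 m3 _ C (fun y => f y.1 * g y.2) h mAB mC fgi hi).
by rewrite [X in X * _](Rintegral_tensor m1 m2 A B f g mA mB fi gi).
Qed.

(** * Angular integrals *)

(** The horizontal part of a direction against the normal (a, b): by Omega_nE,
    Omega . n is sin theta times this function of the longitude. *)
Definition azim {R : realType} (a b phi : R) : R := cos phi * a + sin phi * b.

Lemma continuous_azim {R : realType} (a b : R) : continuous (azim a b).
Proof.
move=> x; apply: cvgD; apply: cvgM; try exact: cvg_cst.
  exact: continuous_cos.
exact: continuous_sin.
Qed.

Lemma azimDpi {R : realType} (a b phi : R) :
  azim a b (phi + pi) = - azim a b phi.
Proof. by rewrite /azim cosDpi sinDpi; ring. Qed.

Lemma integral_azim {R : realType} (a b : R) :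
  \int[lebesgue_measure]_(x in `[0, 2 * pi]) azim a b x = 0.
Proof.
have dF (x : R) : is_derive x 1 (fun x => sin x * a - cos x * b) (azim a b x).
  by apply: is_derive_eq; rewrite /azim /GRing.scale /=; ring.
rewrite (Rintegral_primitive _ dF); last exact: continuous_azim.
  by rewrite mulr_natl cos2pi sin2pi cos0 sin0; ring.
by rewrite mulr_gt0 // pi_gt0.
Qed.

Lemma integral_azim_sqr {R : realType} (a b : R) :
  \int[lebesgue_measure]_(x in `[0, pi]) (azim a b x ^+ 2) =
  (a ^+ 2 + b ^+ 2) * pi / 2.
Proof.
pose F (x : R) := a ^+ 2 / 2 * (x + sin x * cos x)
  + a * b * sin x ^+ 2 + b ^+ 2 / 2 * (x - sin x * cos x).
have dF (x : R) : is_derive x 1 F (azim a b x ^+ 2).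
  apply: is_derive_eq; rewrite /azim /GRing.scale /=.
  have S2 : sin x ^+ 2 = 1 - cos x ^+ 2 by rewrite -(cos2Dsin2 x); ring.
  by field: S2.
rewrite (Rintegral_primitive (pi_gt0 R) dF).
  by rewrite /F cospi sinpi cos0 sin0; field.
move=> x; apply: (cvg_comp (azim a b) (fun z => z ^+ 2)).
  exact: continuous_azim.
exact: exprn_continuous.
Qed.

(** The square of azim where azim is positive, 0 elsewhere. Written with max, it is
    visibly continuous, unlike a square times an indicator. *)
Definition half_sqr {R : realType} (a b phi : R) : R :=
  azim a b phi * Num.max (azim a b phi) 0.

Lemma continuous_half_sqr {R : realType} (a b : R) : continuous (half_sqr a b).
Proof.
move=> x; apply: cvgM; first exact: continuous_azim.
apply: continuous_max; [exact: continuous_azim|exact: cvg_cst].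
Qed.

Lemma half_sqrDpi {R : realType} (a b phi : R) :
  half_sqr a b (phi + pi) = half_sqr (- a) (- b) phi.
Proof.
have azimN : azim (- a) (- b) phi = - azim a b phi by rewrite /azim; ring.
by rewrite /half_sqr azimDpi azimN.
Qed.

Lemma half_sqrD {R : realType} (a b phi : R) :
  half_sqr a b phi + half_sqr (- a) (- b) phi = azim a b phi ^+ 2.
Proof.
have azimN : azim (- a) (- b) phi = - azim a b phi by rewrite /azim; ring.
rewrite /half_sqr azimN; set u := azim a b phi.
by rewrite /Num.max !ltNge; case: (leP 0 u) => u0; case: leP => u1 /=; nra.
Qed.

(** Moving the longitude by pi changes the sign of azim, so it exchanges the half
    circle where azim is positive with the one where it is negative. Folding
    [0, 2 pi] onto [0, pi] thus turns the integral of the truncated square into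
    that of the full square over half a turn. *)
Lemma integral_half_sqr {R : realType} (a b : R) :
  \int[lebesgue_measure]_(x in `[0, 2 * pi]) half_sqr a b x =
  (a ^+ 2 + b ^+ 2) * pi / 2.
Proof.
have pi0 := pi_gt0 R.
have ih := continuous_integrable_cc (continuous_half_sqr a b).
have := @Rintegral_itvB _ _ _ _ pi (ih 0 (2 * pi)).
rewrite !bnd_simp ltW // ler_peMl ?ltW // ?ltr1n // => /(_ isT isT).
rewrite Rintegral_itv_obnd_cbnd; last first.
  apply: integrableS (ih 0 (2 * pi)) => //.
  by apply: subset_itvr; rewrite bnd_simp ltW.
have := Rintegral_shift _ _ _ pi (ltW pi0) (continuous_half_sqr a b).
rewrite add0r (_ : pi + pi = 2 * pi); last by ring.
move=> -> /(canRL (subrK _)) ->.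
under eq_Rintegral do rewrite half_sqrDpi.
rewrite addrC -RintegralD //; last first.
  exact: continuous_integrable_cc (continuous_half_sqr _ _) _ _.
under eq_Rintegral do rewrite half_sqrD.
exact: integral_azim_sqr.
Qed.

Lemma continuous_sinX {R : realType} (k : nat) :
  continuous (fun x : R => sin x ^+ k).
Proof.
move=> x; apply: (cvg_comp sin (fun z => z ^+ k)).
  exact: continuous_sin.
exact: exprn_continuous.
Qed.

Lemma integral_sin_cube {R : realType} :
  \int[lebesgue_measure]_(x in `[0, pi]) (sin x ^+ 3) = 4 / 3 :> R.
Proof.
have dF (x : R) : is_derive x 1 (fun x => 3^-1 * cos x ^+ 3 - cos x) (sin x ^+ 3).
  apply: is_derive_eq; rewrite /GRing.scale /=.
  have S2 : sin x ^+ 2 = 1 - cos x ^+ 2 by rewrite -(cos2Dsin2 x); ring.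
  by rewrite exprS S2; field.
rewrite (Rintegral_primitive (pi_gt0 R) dF) ?cospi ?cos0; first by field.
exact: continuous_sinX.
Qed.

(** * Gaussian moments on the half line *)

Definition gauss_mon {R : realType} (T : R) (k : nat) (v : R) : R :=
  v ^+ k * expR (- v ^+ 2 / (2 * T)).

(** The exponential dominates y ^ (k+2) / (k+2)!, where y = n^2 / (2 T), and
    hence n ^ (2 (k+2)) up to a constant. *)
Lemma gauss_mon_to0 {R : realType} (T : R) (k : nat) : 0 < T ->
  gauss_mon T k.+1 n%:R @[n --> \oo] --> (0 : R).
Proof.
move=> T0; pose c := k.+2`!%:R * (2 * T) ^+ k.+2.
have c0 : 0 < c by rewrite mulr_gt0 ?ltr0n ?fact_gt0 // exprn_gt0 // mulr_gt0.
have cn : c * n.+1%:R^-1 @[n --> \oo] --> (0 : R).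
  by rewrite -[X in _ --> X](mulr0 c); apply: cvgM; [exact: cvg_cst|exact: cvg_harmonic].
rewrite -cvg_shiftS; apply: squeeze_cvgr cn; last exact: cvg_cst.
apply: nearW => n; rewrite /gauss_mon; set x : R := n.+1%:R.
have x1 : 1 <= x by rewrite ler1n.
have x0 : 0 < x by rewrite ltr0n.
rewrite mulr_ge0 ?exprn_ge0 ?expR_ge0 ?(ltW x0) //=.
rewrite mulNr expRN; set y := x ^+ 2 / (2 * T).
have y0 : 0 < y by rewrite divr_gt0 ?exprn_gt0 // mulr_gt0.
rewrite ler_pdivrMr ?expR_gt0 //.
have /(le_trans _) : y ^+ k.+2 / k.+2`!%:R <= expR y.
  by apply: le_trans (expR_ge1Dxn k.+1 (ltW y0)); rewrite lerDr.
have cy : c * (y ^+ k.+2 / k.+2`!%:R) = x ^+ (k.+2 * 2).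
  rewrite /c /y expr_div_n -exprM mulnC; field.
  by rewrite expf_neq0 ?mulf_neq0 ?gt_eqF ?ltr0n ?fact_gt0.
move=> ey; rewrite mulrAC ler_pdivlMr // -exprSr.
apply: le_trans (_ : c * (y ^+ k.+2 / k.+2`!%:R) <= _); last first.
  by rewrite ler_pM2l //; exact: ey.
by rewrite cy ler_weXn2l // leq_pmulr.
Qed.

Lemma gauss_mon_ge0 {R : realType} (T : R) (k : nat) (v : R) :
  0 <= v -> 0 <= gauss_mon T k v.
Proof. by move=> v0; rewrite mulr_ge0 ?exprn_ge0 ?expR_ge0. Qed.

Lemma continuous_gauss_mon {R : realType} (T : R) (k : nat) :
  continuous (gauss_mon T k).
Proof.
move=> x; apply: cvgM; first exact: exprn_continuous.
apply: (cvg_comp (fun z => - z ^+ 2 / (2 * T)) expR); last exact: continuous_expR.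
by apply: cvgM; [apply: cvgN; exact: exprn_continuous|exact: cvg_cst].
Qed.

(** This primitive is the boundary term of the integration by parts that relates the
    moments of orders k + 2 and k. *)
Lemma is_derive_gauss_mon {R : realType} (T : R) (k : nat) (v : R) : 0 < T ->
  is_derive v 1 (fun v => - T * gauss_mon T k.+1 v)
    (gauss_mon T k.+2 v - T * k.+1%:R * gauss_mon T k v).
Proof.
move=> T0; rewrite /gauss_mon.
have dE : is_derive v 1 (fun v => expR (- v ^+ 2 / (2 * T)))
    (expR (- v ^+ 2 / (2 * T)) * (- v / T)).
  apply: (@is_derive1_comp _ expR (fun v => - v ^+ 2 / (2 * T))).
  apply: is_derive_eq; rewrite /GRing.scale /=; field.
  by rewrite gt_eqF.
have dX : is_derive v 1 (fun v => v ^+ k.+1) (k.+1%:R * v ^+ k).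
  apply: DeriveDef; first exact: exprn_derivable.
  by rewrite exp_derive /GRing.scale /= mulr1.
have D := is_deriveZ (- T) (is_deriveM dX dE).
apply: (is_derive_eq D); rewrite /GRing.scale /= !exprS; field.
by rewrite gt_eqF.
Qed.

Lemma integral_gauss_mon_recN {R : realType} (T : R) (k : nat) (x : R) :
  0 < T -> 0 < x ->
  \int[lebesgue_measure]_(v in `[0, x]) gauss_mon T k.+2 v =
  T * k.+1%:R * (\int[lebesgue_measure]_(v in `[0, x]) gauss_mon T k v)
    - T * gauss_mon T k.+1 x.
Proof.
move=> T0 x0; have ci j := continuous_integrable_cc (continuous_gauss_mon T j) 0 x.
have cc : continuous (fun v => gauss_mon T k.+2 v - T * k.+1%:R * gauss_mon T k v).
  move=> v; apply: cvgB; first exact: continuous_gauss_mon.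
  by apply: cvgM; [exact: cvg_cst|exact: continuous_gauss_mon].
have dF v := is_derive_gauss_mon T k v T0.
have := Rintegral_primitive x0 dF cc.
have ic : lebesgue_measure.-integrable `[0, x]
    (EFin \o (fun v => T * k.+1%:R * gauss_mon T k v)).
  exact: integrable_scale.
rewrite RintegralB // RintegralZl //.
move=> /(canRL (subrK _)) ->.
by rewrite /gauss_mon expr0n !mul0r mulr0 subr0 mulNr addrC.
Qed.

(** The identity over [0, n] passes to the limit: the integrals over [0, n] converge by
    monotone convergence and the boundary term vanishes. Integrability of the
    moment of order k + 2 comes out of the computation, as the integral is
    finite. *)
Lemma gauss_mon_rec {R : realType} (T : R) (k : nat) : 0 < T ->
  lebesgue_measure.-integrable `[0, +oo[ (EFin \o gauss_mon T k) ->
  lebesgue_measure.-integrable `[0, +oo[ (EFin \o gauss_mon T k.+2) /\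
  \int[lebesgue_measure]_(v in `[0, +oo[) gauss_mon T k.+2 v =
  T * k.+1%:R * \int[lebesgue_measure]_(v in `[0, +oo[) gauss_mon T k v.
Proof.
move=> T0 ik.
(* Monotone convergence over [0, n] asks for a function which is nonnegative on the
   whole line; for odd orders only the composition with the absolute value is. *)
have eqN j (D : set R) : D `<=` `[0, +oo[ ->
    (\int[lebesgue_measure]_(v in D) (gauss_mon T j v)%:E =
     \int[lebesgue_measure]_(v in D) (gauss_mon T j `|v|)%:E)%E.
  move=> D0; apply: eq_integral => v /set_mem/D0 /=.
  by rewrite in_itv /= andbT => v0; rewrite ger0_norm.
have limN j : (\int[lebesgue_measure]_(v in `[0%R, n%:R]) (gauss_mon T j v)%:E
    @[n --> \oo] -->
    \int[lebesgue_measure]_(v in `[0%R, +oo[) (gauss_mon T j v)%:E)%E.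
  have itvN (n : nat) : `[0, n%:R] `<=` (`[0, +oo[ : set R).
    by move=> v /=; rewrite !in_itv /= andbT => /andP[].
  rewrite eqN //; under eq_fun do rewrite (eqN _ _ (itvN _)).
  apply: (@ge0_cvgn_integral _ _ (fun v => gauss_mon T j `|v|)).
    by move=> v; rewrite gauss_mon_ge0.
  apply: continuous_measurable_fun => v.
  apply: (cvg_comp (fun z : R => `|z|) (gauss_mon T j)).
    by apply: cvg_norm; exact: cvg_id.
  exact: continuous_gauss_mon.
have [c cE] : exists c : R,
    (\int[lebesgue_measure]_(v in `[0%R, +oo[) (gauss_mon T k v)%:E = c%:E)%E.
  exists (fine (\int[lebesgue_measure]_(v in `[0%R, +oo[) (gauss_mon T k v)%:E)%E).
  by rewrite fineK //; exact: integrable_fin_num ik.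
have finN j n : (\int[lebesgue_measure]_(v in `[0%R, n%:R]) (gauss_mon T j v)%:E =
    (\int[lebesgue_measure]_(v in `[0, n%:R]) gauss_mon T j v)%R%:E)%E.
  rewrite /Rintegral fineK //; apply: integrable_fin_num => //.
  exact: continuous_integrable_cc (continuous_gauss_mon T j) 0 n%:R.
have limR : \int[lebesgue_measure]_(v in `[0, n%:R]) gauss_mon T k v
    @[n --> \oo] --> c.
  by have := limN k; rewrite cE => /fine_cvg.
have limR2 : \int[lebesgue_measure]_(v in `[0, n%:R]) gauss_mon T k.+2 v
    @[n --> \oo] --> T * k.+1%:R * c.
  pose I j (n : nat) := \int[lebesgue_measure]_(v in `[0, n%:R]) gauss_mon T j v.
  have limS : I k n.+1 @[n --> \oo] --> c by rewrite (cvg_shiftS (I k)).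
  have lim0 := gauss_mon_to0 T k T0.
  rewrite -(cvg_shiftS (fun n => gauss_mon T k.+1 n%:R)) in lim0.
  rewrite -(cvg_shiftS (I k.+2)).
  have IS : (fun n => I k.+2 n.+1) =
      (fun n => T * k.+1%:R * I k n.+1 - T * gauss_mon T k.+1 n.+1%:R).
    by apply/funext => n; rewrite /I integral_gauss_mon_recN.
  rewrite IS.
  have := @cvgB _ R^o _ _ _ _ _ _ _ (cvgM (cvg_cst (T * k.+1%:R)) limS)
    (cvgM (cvg_cst T) lim0).
  by rewrite mulr0 subr0 => lim; exact: lim.
have rec : (\int[lebesgue_measure]_(v in `[0%R, +oo[) (gauss_mon T k.+2 v)%:E =
    (T * k.+1%:R * c)%:E)%E.
  apply: (cvg_unique _ (limN k.+2)); first exact: ereal_hausdorff.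
  rewrite /= (_ : (fun n : nat => _) = EFin \o (fun n : nat =>
    \int[lebesgue_measure]_(v in `[0, n%:R]) gauss_mon T k.+2 v)); last first.
    by apply/funext => n; rewrite finN.
  apply: cvg_EFin; first exact: nearW.
  exact: limR2.
split; last by rewrite /Rintegral rec cE.
apply/integrableP; split.
  apply/measurable_EFinP; apply: measurable_funTS.
  exact: continuous_measurable_fun (continuous_gauss_mon T _).
under eq_integral => v v0.
  rewrite gee0_abs; last first.
    rewrite lee_fin gauss_mon_ge0 //.
    by move: v0 => /set_mem /=; rewrite in_itv /= andbT.
  over.
by rewrite rec ltry.
Qed.

(** The Gaussian is the density of the centered normal law of variance T up to
    normalization, which gives both its integrability and its integral. *)
Lemma gauss_mon0E {R : realType} (T : R) : 0 < T ->
  gauss_mon T 0 = fun v => Num.sqrt (2 * pi * T) * normal_pdf 0 (Num.sqrt T) v.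
Proof.
move=> T0; apply/funext => v; have sT : Num.sqrt T != 0 by rewrite gt_eqF ?sqrtr_gt0.
rewrite normal_pdfE // /normal_peak /normal_fun sqr_sqrtr ?(ltW T0) //.
rewrite -[T * pi *+ 2]mulr_natl -[T *+ 2]mulr_natl subr0.
rewrite (_ : 2 * (T * pi) = 2 * pi * T); last by ring.
rewrite mulrA divff ?mul1r ?gt_eqF ?sqrtr_gt0 ?mulr_gt0 ?pi_gt0 //.
by rewrite /gauss_mon expr0 mul1r.
Qed.

Lemma integrable_gauss_mon {R : realType} (T : R) (k : nat) : 0 < T ->
  lebesgue_measure.-integrable `[0, +oo[ (EFin \o gauss_mon T k).
Proof.
move=> T0.
have i0 : lebesgue_measure.-integrable `[0, +oo[ (EFin \o gauss_mon T 0).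
  apply: (@integrableS _ _ _ _ setT) => //.
  rewrite gauss_mon0E //; apply: integrable_scale => //.
  exact: integrable_normal_pdf.
have i2 := (gauss_mon_rec T 0 T0 i0).1.
(* The recursion starts at orders 0 and 1; order 1 is dominated by 1 + v^2. *)
have i1 : lebesgue_measure.-integrable `[0, +oo[ (EFin \o gauss_mon T 1).
  have i02 : lebesgue_measure.-integrable `[0, +oo[
      (EFin \o (fun v => gauss_mon T 0 v + gauss_mon T 2 v)).
    exact: integrable_add.
  apply: le_integrable i02 => //.
    apply/measurable_EFinP; apply: measurable_funTS.
    exact: continuous_measurable_fun (continuous_gauss_mon T _).
  move=> v /=; rewrite in_itv /= andbT => v0.
  rewrite lee_fin !ger0_norm ?addr_ge0 ?gauss_mon_ge0 //.
  rewrite /gauss_mon -mulrDl ler_pM2r ?expR_gt0 // expr0 expr1.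
  nra.
suff: lebesgue_measure.-integrable `[0, +oo[ (EFin \o gauss_mon T k) /\
  lebesgue_measure.-integrable `[0, +oo[ (EFin \o gauss_mon T k.+1) by case.
elim: k => [//|k [ik ik1]]; split=> //.
exact: (gauss_mon_rec T k T0 ik).1.
Qed.

Definition gauss_moment {R : realType} (T : R) (k : nat) : R :=
  \int[lebesgue_measure]_(v in `[0, +oo[) gauss_mon T k v.

Lemma gauss_momentS {R : realType} (T : R) (k : nat) : 0 < T ->
  gauss_moment T k.+2 = T * k.+1%:R * gauss_moment T k.
Proof.
by move=> T0; exact: (gauss_mon_rec T k T0 (integrable_gauss_mon T k T0)).2.
Qed.

(** By symmetry, half of the integral over the whole line. *)
Lemma gauss_moment0 {R : realType} (T : R) : 0 < T ->
  gauss_moment T 0 = Num.sqrt (2 * pi * T) / 2.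
Proof.
move=> T0.
have : (\int[lebesgue_measure]_v (gauss_mon T 0 v)%:E =
        (Num.sqrt (2 * pi * T))%:E)%E.
  rewrite gauss_mon0E //.
  under eq_integral do rewrite EFinM.
  rewrite integralZl //; last exact: integrable_normal_pdf.
  by rewrite integral_normal_pdf mule1.
rewrite ge0_symfun_integralT; last 3 first.
- by move=> v; rewrite /gauss_mon mul1r expR_ge0.
- exact: continuous_gauss_mon.
- by move=> v; rewrite /gauss_mon /= sqrrN.
rewrite -set_itvcy /gauss_moment /Rintegral => E.
have fi : (\int[lebesgue_measure]_(v in `[0%R, +oo[) (gauss_mon T 0 v)%:E)%E
    \is a fin_num.
  by apply: integrable_fin_num => //; exact: integrable_gauss_mon.
have : fine (2%:E * \int[lebesgue_measure]_(v in `[0%R, +oo[) (gauss_mon T 0 v)%:E)%E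
    = Num.sqrt (2 * pi * T) by rewrite E.
by rewrite fineM //= => <-; rewrite mulrAC divff ?mul1r.
Qed.

(** The moments needed for the fluxes: a slope of the Maxwellian has degree 2 in the
    speed, it is weighted by v^4, where v^2 comes from the flux and v^2 from the
    volume element, and by 1 or v^2 / 2 from Psi. *)
Lemma gauss_moments {R : realType} (T : R) : 0 < T ->
  [/\ gauss_moment T 4 = 3 / 2 * T ^+ 2 * Num.sqrt (2 * pi * T),
      gauss_moment T 6 = 15 / 2 * T ^+ 3 * Num.sqrt (2 * pi * T) &
      gauss_moment T 8 = 105 / 2 * T ^+ 4 * Num.sqrt (2 * pi * T)].
Proof.
by move=> T0; rewrite !gauss_momentS // gauss_moment0 //; split; field.
Qed.

(** * Brackets *)

Section Brackets.
Context {R : realType}.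
Implicit Types (g h : 'rV[R]_3 -> R -> R) (s p r : R -> R).

Lemma measurable_velocity_domain :
  measurable (@velocity_domain R :
    set (measurableTypeR R * measurableTypeR R * measurableTypeR R)).
Proof. by apply: measurableX => //; exact: measurableX. Qed.

(** The factor v^2 sin theta is the Jacobian of spherical coordinates. Factorization
    is only asked where sin theta is nonnegative, which holds on the whole domain;
    the sign matters for the indicators of half spheres. *)
Lemma bracket_tensor g s p r : continuous s -> continuous p ->
  lebesgue_measure.-integrable `[0, +oo[ (EFin \o r) ->
  (forall theta phi v, 0 <= sin theta ->
    g (direction theta phi) v * v ^+ 2 * sin theta = s theta * p phi * r v) ->
  finite_bracket g /\
  bracket g = (\int[lebesgue_measure]_(x in `[0, pi]) s x) *
              (\int[lebesgue_measure]_(x in `[0, 2 * pi]) p x) *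
              (\int[lebesgue_measure]_(v in `[0, +oo[) r v).
Proof.
move=> cs cp ir gE.
have is0 := continuous_integrable_cc cs 0 pi.
have ip := continuous_integrable_cc cp 0 (2 * pi).
have E : {in @velocity_domain R, bracket_integrand g =1
    (fun x => s x.1.1 * p x.1.2 * r x.2)}.
  move=> [[th ph] v] /set_mem[[/= + _] _]; rewrite in_itv /= => /andP[t0 t1].
  by rewrite /bracket_integrand /= gE // sin_ge0_pi // t0 t1.
have mI (a b : R) : measurable (`[a, b] : set (measurableTypeR R)) by [].
have mr : measurable (`[0, +oo[ : set (measurableTypeR R)) by [].
have [iP vP] := tensor3 (mI _ _) (mI _ _) mr is0 ip ir.
split.
  apply: (eq_integrable measurable_velocity_domain _ _ _ iP).
  by move=> x xD /=; rewrite E.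
rewrite -vP /bracket /Rintegral; congr fine; apply: eq_integral => x xD.
by rewrite E.
Qed.

Lemma finite_bracketZ (k : R) g : finite_bracket g ->
  finite_bracket (fun Om v => k * g Om v) /\
  bracket (fun Om v => k * g Om v) = k * bracket g.
Proof.
move=> gi; have E : bracket_integrand (fun Om v => k * g Om v) =
    fun x => k * bracket_integrand g x.
  by apply/funext => x; rewrite /bracket_integrand -!mulrA.
have mD := measurable_velocity_domain; rewrite /finite_bracket /bracket E.
by split; [exact: integrable_scale|rewrite RintegralZl].
Qed.

Lemma finite_bracketD g h : finite_bracket g -> finite_bracket h ->
  finite_bracket (fun Om v => g Om v + h Om v) /\
  bracket (fun Om v => g Om v + h Om v) = bracket g + bracket h.
Proof.
move=> gi hi; have E : bracket_integrand (fun Om v => g Om v + h Om v) =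
    fun x => bracket_integrand g x + bracket_integrand h x.
  by apply/funext => x; rewrite /bracket_integrand !mulrDl.
have mD := measurable_velocity_domain; rewrite /finite_bracket /bracket E.
by split; [exact: integrable_add|rewrite RintegralD].
Qed.

End Brackets.

(** * Radial moments of the Maxwellian and of its slopes *)

Section MaxwellianMoments.
Context {R : realType}.
Implicit Types (W d : 'cV[R]_2) (v : R).

Lemma temperature_gt0 W : 0 < rho W -> 0 < q W -> 0 < temperature W.
Proof. by move=> r0 q0; rewrite divr_gt0 // mulr_gt0. Qed.

Lemma maxwellianE W v : 0 < rho W -> 0 < q W ->
  maxwellian W v = rho W / (2 * pi * temperature W *
    Num.sqrt (2 * pi * temperature W)) * gauss_mon (temperature W) 0 v.
Proof.
move=> r0 q0; have T0 := temperature_gt0 W r0 q0.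
have a0 : 0 < 2 * pi * temperature W by rewrite mulr_gt0 // mulr_gt0 // pi_gt0.
rewrite /maxwellian /gauss_mon expr0 mul1r (_ : 3 / 2 = 1 + 2^-1); last by field.
rewrite powRD; last by apply/implyP => _; rewrite gt_eqF.
by rewrite powRr1 ?(ltW a0) // powR12_sqrt // ltW.
Qed.

(** The matrix K makes the slope a polynomial in v^2 times the Maxwellian. *)
Lemma maxwellian_slopeE W d v : 0 < rho W -> 0 < q W ->
  maxwellian_slope W d v = maxwellian W v *
    ((5 / (2 * rho W) * rho d - 3 / (2 * q W) * q d) +
     (3 * rho W / (2 * q W ^+ 2) * q d - 3 / (2 * q W) * rho d) / 2 * v ^+ 2).
Proof.
rewrite /rho /q => r0 q0; rewrite /maxwellian_slope /Kmx.
rewrite !mxE !big_ord_recl !big_ord0 !mxE.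
rewrite !big_ord_recl !big_ord0 !mxE /= /rho /q.
rewrite (_ : lift ord0 ord0 = 1); last exact: val_inj.
rewrite (_ : ord0 = 0); last exact: val_inj.
rewrite /=; set M := maxwellian W v.
by field; rewrite !gt_eqF.
Qed.

Lemma integral_gauss_mon2 (T a b : R) (j k : nat) (r : R -> R) : 0 < T ->
  (forall v, r v = a * gauss_mon T j v + b * gauss_mon T k v) ->
  lebesgue_measure.-integrable `[0, +oo[ (EFin \o r) /\
  \int[lebesgue_measure]_(v in `[0, +oo[) r v =
    a * gauss_moment T j + b * gauss_moment T k.
Proof.
move=> T0 rE; have ig k := integrable_gauss_mon T k T0.
have mI : measurable (`[0, +oo[ : set (measurableTypeR R)) by [].
have iaj := integrable_scale a mI (ig j); have ibk := integrable_scale b mI (ig k).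
have -> : r = fun v => a * gauss_mon T j v + b * gauss_mon T k v by apply/funext.
split; first exact: integrable_add mI iaj ibk.
by rewrite RintegralD // !RintegralZl.
Qed.

Lemma Psi0 v : Psi v 0 0 = 1. Proof. by rewrite mxE. Qed.
Lemma Psi1 v : Psi v 1 0 = v ^+ 2 / 2. Proof. by rewrite mxE. Qed.

Lemma integrable_equilibrium_moment W i : 0 < rho W -> 0 < q W ->
  lebesgue_measure.-integrable `[0, +oo[
    (EFin \o (fun v => v ^+ 3 * (Psi v i 0 * maxwellian W v))).
Proof.
move=> r0 q0; have T0 := temperature_gt0 W r0 q0.
have [c cE] : exists c, forall v,
    maxwellian W v = c * gauss_mon (temperature W) 0 v.
  by eexists => v; exact: maxwellianE.
move: i; case; case=> [|[|//]] lti.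
  rewrite (_ : Ordinal lti = 0); last exact: val_inj.
  apply: (integral_gauss_mon2 _ c 0 3 3 _ T0 _).1 => v.
  by rewrite Psi0 cE /gauss_mon; ring.
rewrite (_ : Ordinal lti = 1); last exact: val_inj.
apply: (integral_gauss_mon2 _ (c / 2) 0 5 5 _ T0 _).1 => v.
by rewrite Psi1 cE /gauss_mon; ring.
Qed.

(** Through T = 2 q / (3 rho), the coefficient of the slope of rho cancels, so the
    mass flux only sees the gradient of q. *)
Lemma slope_moment_rho W d : 0 < rho W -> 0 < q W ->
  lebesgue_measure.-integrable `[0, +oo[
    (EFin \o (fun v => v ^+ 4 * (Psi v 0 0 * maxwellian_slope W d v))) /\
  \int[lebesgue_measure]_(v in `[0, +oo[)
    (v ^+ 4 * (Psi v 0 0 * maxwellian_slope W d v)) = q d / (2 * pi).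
Proof.
move=> r0 q0; have T0 := temperature_gt0 W r0 q0.
set T := temperature W in T0; set s := Num.sqrt (2 * pi * T).
have pi0 := pi_gt0 R.
have s0 : 0 < s by rewrite sqrtr_gt0 mulr_gt0 // mulr_gt0.
pose c := rho W / (2 * pi * T * s).
pose al := 5 / (2 * rho W) * rho d - 3 / (2 * q W) * q d.
pose be := (3 * rho W / (2 * q W ^+ 2) * q d - 3 / (2 * q W) * rho d) / 2.
have [|ir ->] := @integral_gauss_mon2 T (c * al) (c * be) 4 6
    (fun v => v ^+ 4 * (Psi v 0 0 * maxwellian_slope W d v)) T0.
  move=> v; rewrite Psi0 maxwellian_slopeE // maxwellianE //.
  by rewrite -/T -/s -/c -/al -/be /gauss_mon; ring.
split=> //; have [-> -> _] := gauss_moments T T0.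
rewrite -/s /c /al /be (_ : T = 2 * q W / (3 * rho W)) //.
by move: (@pi R) pi0 => p p0; field; rewrite !gt_eqF.
Qed.

(** The coefficients are those of the derivative of (5/3) q^2 / rho, the energy
    gradient of the diffusion system. *)
Lemma slope_moment_q W d : 0 < rho W -> 0 < q W ->
  lebesgue_measure.-integrable `[0, +oo[
    (EFin \o (fun v => v ^+ 4 * (Psi v 1 0 * maxwellian_slope W d v))) /\
  \int[lebesgue_measure]_(v in `[0, +oo[)
    (v ^+ 4 * (Psi v 1 0 * maxwellian_slope W d v)) =
    5 * q W ^+ 2 / (3 * rho W) * (- (rho W)^-1 * rho d + 2 / q W * q d) / (2 * pi).
Proof.
move=> r0 q0; have T0 := temperature_gt0 W r0 q0.
set T := temperature W in T0; set s := Num.sqrt (2 * pi * T).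
have pi0 := pi_gt0 R.
have s0 : 0 < s by rewrite sqrtr_gt0 mulr_gt0 // mulr_gt0.
pose c := rho W / (2 * pi * T * s).
pose al := 5 / (2 * rho W) * rho d - 3 / (2 * q W) * q d.
pose be := (3 * rho W / (2 * q W ^+ 2) * q d - 3 / (2 * q W) * rho d) / 2.
have [|ir ->] := @integral_gauss_mon2 T (c * al / 2) (c * be / 2) 6 8
    (fun v => v ^+ 4 * (Psi v 1 0 * maxwellian_slope W d v)) T0.
  move=> v; rewrite Psi1 maxwellian_slopeE // maxwellianE //.
  by rewrite -/T -/s -/c -/al -/be /gauss_mon; field.
split=> //; have [_ -> ->] := gauss_moments T T0.
rewrite -/s /c /al /be (_ : T = 2 * q W / (3 * rho W)) //.
by move: (@pi R) pi0 => p p0; field; rewrite !gt_eqF.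
Qed.

End MaxwellianMoments.

(** * Brackets of the three parts of the flux *)

Section FluxBrackets.
Context {R : realType}.
Implicit Types (n : 'rV[R]_2) (theta phi v : R) (W d : 'cV[R]_2).

Lemma Omega_nE n theta phi :
  Omega_n n (direction theta phi) = sin theta * azim (n 0 0) (n 0 1) phi.
Proof.
rewrite /Omega_n /dot /direction.
rewrite (@big_split_ord _ _ _ 2 1) /= !big_ord_recl !big_ord0.
rewrite (@row_mxEr _ 1 2 1) !(@row_mxEl _ 1 2 1) !mxE /=.
rewrite (_ : ord0 = 0); last exact: val_inj.
rewrite (_ : lift _ _ = 1); last exact: val_inj.
by rewrite /azim; ring.
Qed.

Lemma Omega_nN n Om : Omega_n (- n) Om = - Omega_n n Om.
Proof.
rewrite /Omega_n (_ : row_mx (- n) 0 = - row_mx n (0 : 'rV[R]_1)); last first.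
  by rewrite opp_row_mx oppr0.
by rewrite /dot -sumrN; apply: eq_bigr => i _; rewrite mxE mulrN.
Qed.

Lemma unit_normal_sqr n : enorm n = 1 -> n 0 0 ^+ 2 + n 0 1 ^+ 2 = 1.
Proof.
move=> n1; have d0 : 0 <= dot n n.
  by apply: sumr_ge0 => i _; rewrite -expr2 sqr_ge0.
rewrite -[RHS](expr1n _ 2) -n1 /enorm sqr_sqrtr // /dot !big_ord_recl big_ord0.
rewrite (_ : lift _ _ = 1); last exact: val_inj.
by rewrite addr0 !expr2.
Qed.

(** An isotropic distribution carries no flux: azim has mean zero over a turn. *)
Lemma bracket_equilibrium n (r : R -> R) :
  lebesgue_measure.-integrable `[0, +oo[ (EFin \o (fun v => v ^+ 3 * r v)) ->
  finite_bracket (fun Om v => v * Omega_n n Om * r v) /\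
  bracket (fun Om v => v * Omega_n n Om * r v) = 0.
Proof.
move=> ir.
have [|fb ->] := @bracket_tensor _ (fun Om v => v * Omega_n n Om * r v)
  (fun theta => sin theta ^+ 2) (azim (n 0 0) (n 0 1)) _
  (continuous_sinX 2) (continuous_azim _ _) ir.
  by move=> theta phi v _; rewrite Omega_nE; ring.
by rewrite integral_azim mulr0 mul0r.
Qed.

(** The half sphere has half of the second moment 4 pi / 3 of the unit sphere along n:
    4/3 from the colatitude times pi/2 from the longitude. *)
Lemma bracket_half_space n (r : R -> R) : enorm n = 1 ->
  lebesgue_measure.-integrable `[0, +oo[ (EFin \o (fun v => v ^+ 4 * r v)) ->
  finite_bracket (fun Om v =>
    v ^+ 2 * Omega_n n Om ^+ 2 * (r v * (0 < Omega_n n Om)%R%:R)) /\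
  bracket (fun Om v =>
    v ^+ 2 * Omega_n n Om ^+ 2 * (r v * (0 < Omega_n n Om)%R%:R)) =
  2 * pi / 3 * \int[lebesgue_measure]_(v in `[0, +oo[) (v ^+ 4 * r v).
Proof.
move=> n1 ir.
have [|fb ->] := @bracket_tensor _ (fun Om v =>
    v ^+ 2 * Omega_n n Om ^+ 2 * (r v * (0 < Omega_n n Om)%R%:R))
  (fun theta => sin theta ^+ 3) (half_sqr (n 0 0) (n 0 1)) _
  (continuous_sinX 3)
  (continuous_half_sqr _ _) ir.
  move=> theta phi v s0; rewrite Omega_nE /half_sqr; set u := azim _ _ _.
  (* At the poles the indicator of Omega . n > 0 is lost, but both sides vanish. *)
have [->|sn0] := eqVneq (sin theta) 0; first by rewrite !(mulr0, mul0r, expr0n).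
  rewrite pmulr_rgt0 ?lt_def ?sn0 // -lt_def /Num.max.
  by case: (ltrgtP u 0) => u0 /=; rewrite ?u0; ring.
split=> //; rewrite integral_sin_cube integral_half_sqr unit_normal_sqr //.
by congr (_ * _); move: (@pi R) => p; field.
Qed.

End FluxBrackets.

(** * The coefficients in the diffusion limit *)

Section Coefficients.
Context {R : realType} (sigma dt : R).
Context (sigma_gt0 : 0 < sigma) (dt_gt0 : 0 < dt).

Let k := sigma * dt.
Let k_gt0 : 0 < k. Proof. exact: mulr_gt0. Qed.

Lemma relaxationE (eps : R) : 0 < eps ->
  relaxation eps eps dt sigma = - (k / eps ^+ 2).
Proof. by move=> e0; rewrite /relaxation /k; field; rewrite gt_eqF. Qed.

Lemma cvg_pow_div (j : nat) : eps ^+ j.+1 / k @[eps --> 0^'+] --> (0 : R).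
Proof.
have pow0 : eps ^+ j.+1 @[eps --> (0 : R)] --> (0 : R) ^+ j.+1.
  exact: exprn_continuous.
have := cvgM pow0 (cvg_cst k^-1); rewrite expr0n mul0r => lim.
by apply: cvg_at_right_filter; exact: lim.
Qed.

(** From 1 + x <= exp x at x = k / eps^2. *)
Lemma expR_relaxation_bounds (eps : R) : 0 < eps ->
  0 <= expR (relaxation eps eps dt sigma) <= eps ^+ 2 / k.
Proof.
move=> e0; rewrite expR_ge0 relaxationE // expRN /=.
rewrite -[leRHS]invf_div lef_pV2 ?posrE ?expR_gt0 ?divr_gt0 ?exprn_gt0 //.
by apply: le_trans (expR_ge1Dx _); rewrite lerDr.
Qed.

Lemma cvg_expR_relaxation :
  expR (relaxation eps eps dt sigma) @[eps --> 0^'+] --> (0 : R).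
Proof.
apply: squeeze_cvgr (cvg_pow_div 1); last exact: cvg_cst.
near=> eps; apply: expR_relaxation_bounds; near: eps; exact: nbhs_right_gt.
Unshelve. all: by end_near. Qed.

Lemma expR_quotientE (eps : R) : 0 < eps ->
  let w := relaxation eps eps dt sigma in
  (1 - expR w) / w = - ((1 - expR w) * (eps ^+ 2 / k)).
Proof.
move=> e0 /=; set E := expR _; rewrite relaxationE //.
by field; rewrite !gt_eqF.
Qed.

(** A is eps / k up to the bounded factor 1 - exp w: the transport of the cell
    distributions disappears in the limit. *)
Lemma cvg_coefA : coefA eps eps dt sigma @[eps --> 0^'+] --> (0 : R).
Proof.
apply: squeeze_cvgr (cvg_pow_div 0); last exact: cvg_cst.
near=> eps; have e0 : 0 < eps by near: eps; exact: nbhs_right_gt.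
have w0 : relaxation eps eps dt sigma <= 0.
  by rewrite relaxationE // oppr_le0 ltW // divr_gt0 // exprn_gt0.
rewrite /coefA expR_quotientE //; set E := expR _.
have E0 : 0 <= E by exact: expR_ge0.
have E1 : E <= 1 by rewrite -expR0 ler_expR.
have -> : - eps^-1 * - ((1 - E) * (eps ^+ 2 / k)) = (1 - E) * (eps / k).
  by field; rewrite !gt_eqF.
have ek : 0 < eps / k by rewrite divr_gt0.
by rewrite expr1 mulr_ge0 ?subr_ge0 ?(ltW ek) //= ler_piMl ?(ltW ek) // lerBlDr lerDl.
Unshelve. all: by end_near. Qed.

(** As w goes to minus infinity, both exp w and (1 - exp w) / w vanish and the
    parenthesis of D tends to 1. *)
Lemma cvg_coefD : Defs.coefD eps eps dt sigma @[eps --> 0^'+] --> - sigma^-1.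
Proof.
have lim : - sigma^-1 * (1 + expR (relaxation eps eps dt sigma) -
    2 * ((1 - expR (relaxation eps eps dt sigma)) * (eps ^+ 2 / k)))
    @[eps --> 0^'+] --> - sigma^-1 * (1 + 0 - 2 * ((1 - 0) * 0)).
  have ce := cvg_expR_relaxation.
  apply: cvgM; first exact: cvg_cst.
  apply: cvgB; first by apply: cvgD => //; exact: cvg_cst.
  apply: cvgM; first exact: cvg_cst.
  apply: cvgM; last exact: (cvg_pow_div 1).
  by apply: cvgB => //; exact: cvg_cst.
rewrite mulr0 addr0 mulr0 subr0 mulr1 in lim.
apply: cvg_trans lim; apply: near_eq_cvg.
near=> eps; have e0 : 0 < eps by near: eps; exact: nbhs_right_gt.
rewrite /Defs.coefD expR_quotientE //; set E := expR _.
by field; rewrite !gt_eqF.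
Unshelve. all: by end_near. Qed.

End Coefficients.

(** The term in C_0 is the only one whose coefficient blows up, and its bracket
    vanishes for every eps. The other coefficients multiply brackets that do not
    depend on eps. The indicator of Omega . n < 0 is handled as that of
    Omega . (- n) > 0. *)
Lemma macro_fluxE {R : realType} (dt sigma : R) (n : 'rV[R]_2)
    (fK fL : 'rV[R]_3 -> R -> R) (We dm dp : 'cV[R]_2) (i : 'I_2) :
  enorm n = 1 -> 0 < rho We -> 0 < q We ->
  finite_bracket (fun Om v =>
    Psi v i 0 * (v * Omega_n n Om * (fK Om v * (0 < Omega_n n Om)%R%:R))) ->
  finite_bracket (fun Om v =>
    Psi v i 0 * (v * Omega_n n Om * (fL Om v * (Omega_n n Om < 0)%R%:R))) ->
  (forall d, lebesgue_measure.-integrable `[0, +oo[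
    (EFin \o (fun v => v ^+ 4 * (Psi v i 0 * maxwellian_slope We d v)))) ->
  exists S, forall eps eta, macro_flux eps eta dt sigma n fK fL We dm dp i 0 =
    coefA eps eta dt sigma * S + Defs.coefD eps eta dt sigma * (2 * pi / 3 *
     (\int[lebesgue_measure]_(v in `[0, +oo[)
        (v ^+ 4 * (Psi v i 0 * maxwellian_slope We dm v)) +
      \int[lebesgue_measure]_(v in `[0, +oo[)
        (v ^+ 4 * (Psi v i 0 * maxwellian_slope We dp v)))).
Proof.
move=> n1 r0 q0 fbK fbL ir.
have [fbM bM] := bracket_equilibrium n
  (fun v => Psi v i 0 * maxwellian We v) (integrable_equilibrium_moment We i r0 q0).
have [fbm bm] := bracket_half_space n
  (fun v => Psi v i 0 * maxwellian_slope We dm v) n1 (ir dm).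
have n1' : enorm (- n) = 1.
  by rewrite /enorm /dot; under eq_bigr do rewrite !mxE mulrNN.
have [fbp bp] := bracket_half_space (- n)
  (fun v => Psi v i 0 * maxwellian_slope We dp v) n1' (ir dp).
have [fb1 b1] := finite_bracketD _ _ fbK fbL.
have [fb3 b3] := finite_bracketD _ _ fbm fbp.
eexists => eps eta; rewrite mxE.
set cA := coefA _ _ _ _; set cD := Defs.coefD _ _ _ _.
pose cC := Defs.coefC eps eta dt sigma.
have [fb1' b1'] := finite_bracketZ cA _ fb1.
have [fb2 b2] := finite_bracketZ cC _ fbM.
have [fb3' b3'] := finite_bracketZ cD _ fb3.
have [fb12 b12] := finite_bracketD _ _ fb1' fb2.
have [_ b123] := finite_bracketD _ _ fb12 fb3'.
apply: (etrans _ (etrans b123 _)).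
  congr bracket; apply/funext => Om; apply/funext => v.
  rewrite /micro_flux -/cA -/cC -/cD /upwind_flux Omega_nN oppr_gt0.
  by ring.
by rewrite b12 b1' b2 bM mulr0 addr0 b3' b3 bm bp -mulrDr.
Qed.

(** * Geometry of an interior edge *)

Section Linear.
Context {R : realType} {d : nat}.
Implicit Types x y n : 'rV[R]_d.

Lemma dotDl x y n : dot (x + y) n = dot x n + dot y n.
Proof.
by rewrite /dot -big_split; apply: eq_bigr => i _; rewrite mxE mulrDl.
Qed.

Lemma dotZl (k : R) x n : dot (k *: x) n = k * dot x n.
Proof.
by rewrite /dot mulr_sumr; apply: eq_bigr => i _; rewrite mxE mulrA.
Qed.

Lemma dotBl x y n : dot (x - y) n = dot x n - dot y n.
Proof. by rewrite -scaleN1r dotDl dotZl mulN1r. Qed.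

End Linear.

Lemma crossE {R : realType} (x y : 'rV[R]_2) :
  cross x y = x 0 0 * y 0 1 - x 0 1 * y 0 0.
Proof.
have E0 j : (col_mx x y : 'M[R]_2) 0 j = x 0 j.
  by rewrite -[RHS](col_mxEu x y 0 j); congr (col_mx x y _ j); exact: val_inj.
have E1 j : (col_mx x y : 'M[R]_2) 1 j = y 0 j.
  by rewrite -[RHS](col_mxEd x y 0 j); congr (col_mx x y _ j); exact: val_inj.
have L (i : 'I_2) : lift i 0 = if i == 0 then 1 else 0.
  by move: i => [[|[|//]] ?]; exact: val_inj.
have det2 (A : 'M[R]_2) : \det A = A 0 0 * A 1 1 - A 0 1 * A 1 0.
  rewrite (expand_det_row _ 0) !big_ord_recl big_ord0 /cofactor !det_mx11.
  by rewrite !mxE !L !eqxx /= expr0 expr1; ring.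
by rewrite /cross det2 !E0 !E1.
Qed.

(** Cramer's rule. *)
Lemma cross_cramer {R : realType} {x y : 'rV[R]_2} (z : 'rV[R]_2) : cross x y != 0 ->
  z = (cross z y / cross x y) *: x + (cross x z / cross x y) *: y.
Proof.
move=> xy0; apply/rowP => i; rewrite !mxE.
rewrite mulrAC [X in _ + X]mulrAC -mulrDl; apply: (canRL (mulfK xy0)).
rewrite !crossE; move: i; case; case=> [|[|//]] ltp.
  by rewrite (_ : Ordinal ltp = 0); [ring|exact: val_inj].
by rewrite (_ : Ordinal ltp = 1); [ring|exact: val_inj].
Qed.

Lemma cards3_neq {V : finType} {a b c : V} :
  #|[set a; b; c]%SET| = 3%N -> [/\ a != b, a != c & b != c].
Proof.
rewrite -finset.setUA cardsU1 cards2 !inE.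
by case: (a == b); case: (a == c); case: (b == c).
Qed.

Lemma sum_set3 {V : finType} {M : nmodType} (g : V -> M) (a b c : V) :
  #|[set a; b; c]%SET| = 3%N ->
  \sum_(v in [set a; b; c]%SET) g v = g a + g b + g c.
Proof.
move=> /cards3_neq[ab ac bc]; rewrite -finset.setUA.
rewrite big_setU1 ?inE ?negb_or ?ab ?ac //= big_setU1 ?inE ?bc //= big_set1.
by rewrite addrA.
Qed.

Lemma sum_set2 {V : finType} {M : nmodType} (g : V -> M) (a b : V) : a != b ->
  \sum_(v in [set a; b]%SET) g v = g a + g b.
Proof. by move=> ab; rewrite big_setU1 ?inE ?ab //= big_set1. Qed.

Lemma card3_set2D {V : finType} {K : {set V}} {a b : V} :
  #|K| = 3%N -> a != b -> a \in K -> b \in K ->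
  exists2 c, c \in K :\: [set a; b]%SET & K = [set a; b; c]%SET.
Proof.
move=> K3 ab aK bK.
have abK : [set a; b]%SET \subset K by rewrite finset.subUset !finset.sub1set aK bK.
have /cards1P[c Ec] : #|K :\: [set a; b]%SET| == 1%N.
  by rewrite cardsD (finset.setIidPr abK) K3 cards2 ab.
exists c; first by rewrite Ec set11.
by rewrite -[LHS](finset.setID K [set a; b]%SET) Ec (finset.setIidPr abK).
Qed.

Lemma mem_convex_hull3 {R : realType} {V : finType} (pos : V -> 'rV[R]_2)
    (a b c : V) (wa wb wc : R) :
  #|[set a; b; c]%SET| = 3%N -> 0 <= wa -> 0 <= wb -> 0 <= wc ->
  wa + wb + wc = 1 ->
  convex_hull pos [set a; b; c]%SET (wa *: pos a + wb *: pos b + wc *: pos c).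
Proof.
move=> K3 wa0 wb0 wc0 w1.
have [ab ac bc] := cards3_neq K3.
pose w v := if v == a then wa else if v == b then wb else wc.
have [wE1 wE2 wE3] : [/\ w a = wa, w b = wb & w c = wc].
  rewrite /w !eqxx (eq_sym b a) (eq_sym c a) (eq_sym c b).
  by rewrite (negPf ab) (negPf ac) (negPf bc).
exists w; split; last by rewrite sum_set3 // wE1 wE2 wE3.
- by move=> v _; rewrite /w; case: ifP => // _; case: ifP.
- by rewrite sum_set3 // wE1 wE2 wE3.
Qed.

(** The weights of the vertices a and b at a point moved by t from the midpoint of
    [a, b] towards a point with barycentric coordinates (1 - ga - be, be, ga): for
    t small they are still nonnegative. *)
Lemma small_weight {R : realType} {ga : R} (be : R) : 0 < ga ->
  exists t : R, [/\ 0 < t, 0 <= 1 - t, 0 <= (1 - t) / 2 + t * (1 - ga - be)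
    & 0 <= (1 - t) / 2 + t * be].
Proof.
move=> ga_gt0; have be1 := ler_norm be; have be2 := ler_norm (- be).
rewrite normrN in be2; have be0 := normr_ge0 be.
have s_gt0 : 0 < 3 + 2 * (`|be| + ga) by lra.
pose t := (3 + 2 * (`|be| + ga))^-1.
have t_gt0 : 0 < t by rewrite invr_gt0.
have ts : t * (3 + 2 * (`|be| + ga)) = 1 by rewrite mulVf // gt_eqF.
have tbe1 : t * be <= t * `|be| by rewrite ler_pM2l.
have tbe2 : - (t * be) <= t * `|be| by rewrite -mulrN ler_pM2l.
have tga : 0 < t * ga by rewrite mulr_gt0.
by exists t; split=> //; lra.
Qed.

Section InteriorEdge.
Context {R : realType} {V : finType} (Th : trimesh R V).

Lemma barycenter3 (a b c : V) : #|[set a; b; c]%SET| = 3%N ->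
  barycenter Th [set a; b; c]%SET = 3^-1 *: (pos Th a + pos Th b + pos Th c).
Proof. by move=> K3; rewrite /barycenter sum_set3. Qed.

(** Otherwise the third vertex c' of the second triangle would lie strictly on the
    same side of the edge as c, since it cannot be on the line of the edge. A
    point slightly off the midpoint of the edge, towards c', would then belong to
    both triangles without belonging to the edge, which conformity forbids. *)
Lemma opposite_sides {a b c c' : V} {n : 'rV[R]_2} : a != b ->
  [set a; b; c]%SET \in cells Th -> [set a; b; c']%SET \in cells Th ->
  [set a; b; c]%SET :&: [set a; b; c']%SET = [set a; b]%SET ->
  dot (pos Th b - pos Th a) n = 0 -> dot (pos Th c - pos Th a) n < 0 ->
  0 < dot (pos Th c' - pos Th a) n.
Proof.
move=> ab KT LT KL bn cn; rewrite ltNge; apply/negP => c'n.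
have crK := cell_nondegenerate KT (erefl _).
have crL := cell_nondegenerate LT (erefl _).
have := cross_cramer (pos Th c' - pos Th a) crK.
set x := pos Th b - pos Th a in bn crK crL *.
set y := pos Th c - pos Th a in cn crK *.
set z := pos Th c' - pos Th a in c'n crL *.
set be := cross z y / cross x y; set ga := cross x z / cross x y => Ez.
have ga_neq0 : ga != 0 by rewrite mulf_neq0 // invr_neq0.
have zn : dot z n = ga * dot y n by rewrite {1}Ez dotDl !dotZl bn mulr0 add0r.
have ga_gt0 : 0 < ga.
  rewrite lt_def ga_neq0 /=; move: c'n; rewrite zn => c'n.
  by rewrite leNgt; apply/negP => ga0; move: c'n; rewrite leNgt nmulr_rgt0 ?cn.
have [t [t_gt0 t1 ta tb]] := small_weight be ga_gt0.
(* p is the point of the common part: a small step from the midpoint towards c'. *)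
pose p := ((1 - t) / 2) *: pos Th a + ((1 - t) / 2) *: pos Th b + t *: pos Th c'.
have pL : convex_hull (pos Th) [set a; b; c']%SET p.
  apply: mem_convex_hull3; rewrite ?(cell_card LT) ?(ltW t_gt0) //.
  - by rewrite divr_ge0.
  - by rewrite divr_ge0.
  - by field.
have pE : p = ((1 - t) / 2 + t * (1 - ga - be)) *: pos Th a
    + ((1 - t) / 2 + t * be) *: pos Th b + (t * ga) *: pos Th c.
  have -> : p = ((1 - t) / 2) *: pos Th a + ((1 - t) / 2) *: pos Th b
      + t *: (pos Th a + z) by rewrite /p /z [_ + (_ - _)]addrC subrK.
  by rewrite {1}Ez; apply/rowP => i; rewrite /x /y !mxE; ring.
have pK : convex_hull (pos Th) [set a; b; c]%SET p.
  rewrite pE; apply: mem_convex_hull3; rewrite ?(cell_card KT) //.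
    by rewrite mulr_ge0 ?ltW.
  by field.
have : convex_hull (pos Th) [set a; b]%SET p.
  by rewrite -KL -(cell_conforming KT LT); split.
move=> [w [_]]; rewrite !sum_set2 // => w1 pE2.
have : dot (p - pos Th a) n = 0.
  have -> : p - pos Th a = w b *: x.
    have wa : w a = 1 - w b by rewrite -w1 addrK.
    by rewrite pE2 wa /x; apply/rowP => i; rewrite !mxE; ring.
  by rewrite dotZl bn mulr0.
have -> : p - pos Th a = ((1 - t) / 2 + t * be) *: x + (t * ga) *: y.
  by rewrite pE /x /y; apply/rowP => i; rewrite !mxE; field.
rewrite dotDl !dotZl bn mulr0 add0r => /eqP.
by rewrite mulf_eq0 (gt_eqF (mulr_gt0 t_gt0 ga_gt0)) (lt_eqF cn).
Qed.

(** The distance of the barycenter of a triangle to the line of the edge is a third of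
    that of the opposite vertex, and the two opposite vertices lie on different
    sides. *)
Lemma edge_distances_gt0 {e K L : {set V}} {xs n : 'rV[R]_2} :
  separates Th e K L -> outward_normal Th K e n -> convex_hull (pos Th) e xs ->
  0 < dot (xs - barycenter Th K) n /\ 0 < dot (barycenter Th L - xs) n.
Proof.
move=> [KT LT _ eKL e2] [_ en cn] [w [_ w1 xsE]].
have /cards2P[a [b [ab Ee]]] : #|e| == 2%N by rewrite e2.
have [ae be] : a \in e /\ b \in e by rewrite Ee !inE !eqxx orbT.
have [aK aL] : a \in K /\ a \in L by move: ae; rewrite eKL inE => /andP.
have [bK bL] : b \in K /\ b \in L by move: be; rewrite eKL inE => /andP.
have [c cK KE] := card3_set2D (cell_card KT) ab aK bK.
have [c' _ LE] := card3_set2D (cell_card LT) ab aL bL.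
have K3 := cell_card KT; have L3 := cell_card LT.
have bn := en _ _ ae be.
have {}cn : dot (pos Th c - pos Th a) n < 0 by apply: cn; rewrite // Ee.
rewrite Ee !sum_set2 // in w1 xsE.
rewrite Ee KE LE in KT LT eKL K3 L3 *.
have c'n := opposite_sides ab KT LT (esym eKL) bn cn.
have xsn : dot xs n = dot (pos Th a) n.
  rewrite xsE dotDl !dotZl; move: bn; rewrite dotBl => /subr0_eq ->.
  by rewrite -mulrDl w1 mul1r.
rewrite !dotBl !barycenter3 // !dotZl !dotDl xsn.
move: bn cn c'n; rewrite !dotBl => *; split; lra.
Qed.

End InteriorEdge.

(** * Interface state, consistency and the limit of the fluxes *)

Section InterfaceState.
Context {R : realType} (hm hp : R) (W1 W2 : 'cV[R]_2).
Context (hm_gt0 : 0 < hm) (hp_gt0 : 0 < hp).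

(** The interface state is the linear interpolation of the cell states at distances
    hm and hp. *)
Lemma interface_stateE i : interface_state hm hp (hm + hp) W1 W2 i 0 =
  (hp * W1 i 0 + hm * W2 i 0) / (hm + hp).
Proof. by rewrite !mxE; field; rewrite gt_eqF // addr_gt0. Qed.

Lemma interface_state_gt0 i : 0 < W1 i 0 -> 0 < W2 i 0 ->
  0 < interface_state hm hp (hm + hp) W1 W2 i 0.
Proof.
by move=> W10 W20; rewrite interface_stateE divr_gt0 ?addr_gt0 // mulr_gt0.
Qed.

(** With linear interpolation, both one-sided difference quotients equal
    (W2 - W1) / (hm + hp). *)
Lemma mean_half_slope (kappa len : R) (Wm Wp : 'cV[R]_2) :
  let We := interface_state hm hp (hm + hp) W1 W2 in
  2^-1 *: (half_slope hm kappa len W1 We Wm Wp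
           + half_slope hp kappa len We W2 Wm Wp)
    = (hm + hp)^-1 *: (W2 - W1) - (kappa / len) *: (Wp - Wm).
Proof.
move=> We; apply/colP => i; rewrite /half_slope.
have WE : We i 0 = (hp * W1 i 0 + hm * W2 i 0) / (hm + hp).
  exact: interface_stateE.
move: (kappa / len) We WE => k We WE; rewrite !mxE WE.
by field; rewrite !gt_eqF // addr_gt0.
Qed.

End InterfaceState.

Lemma opacity_gt0 {R : realType} (C : R) (W : 'cV[R]_2) :
  0 < C -> 0 < rho W -> 0 < q W -> 0 < opacity C W.
Proof.
move=> C0 r0 q0; rewrite divr_gt0 ?mulr_gt0 // powR_gt0 //.
exact: temperature_gt0.
Qed.

Theorem mainTheorem4 (R : realType) (V : finType) (Th : trimesh R V)
    (e K L : {set V}) (xm xp : V) (n tau xs : 'rV[R]_2) (C dt : R)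
    (W : {set V} -> 'cV[R]_2) (Wm Wp : 'cV[R]_2)
    (f : {set V} -> 'rV[R]_3 -> R -> R)
    (e_KL : separates Th e K L)
    (n_normal : outward_normal Th K e n)
    (tau_tangent : direct_tangent Th e n tau)
    (e_ends : end_points Th e tau xm xp)
    (xs_e : convex_hull (pos Th) e xs)
    (xs_line : line (barycenter Th K) (barycenter Th L) xs)
    (dt_gt0 : 0 < dt) (C_gt0 : 0 < C)
    (W_gt0 : forall T, T \in cells Th -> 0 < rho (W T) /\ 0 < q (W T))
    (Wm_lsq : forall i, lsq_vertex_value Th (fun T => W T i 0) xm (Wm i 0))
    (Wp_lsq : forall i, lsq_vertex_value Th (fun T => W T i 0) xp (Wp i 0))
    (fK_moments : forall i, finite_bracket (fun Om v =>
       Psi v i 0 * (v * Omega_n n Om * (f K Om v * (0 < Omega_n n Om)%R%:R))))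
    (fL_moments : forall i, finite_bracket (fun Om v =>
       Psi v i 0 * (v * Omega_n n Om * (f L Om v * (Omega_n n Om < 0)%R%:R)))) :
  let xK := barycenter Th K in
  let xL := barycenter Th L in
  let h := dot (xL - xK) n in
  let hm := dot (xs - xK) n in
  let hp := dot (xL - xs) n in
  let kappa := dot (xL - xK) tau / dot (xL - xK) n in
  let len := enorm (pos Th xp - pos Th xm) in
  let sigma := (opacity C (W K) + opacity C (W L)) / 2 in
  let We := interface_state hm hp h (W K) (W L) in
  let dWm := half_slope hm kappa len (W K) We Wm Wp in
  let dWp := half_slope hp kappa len We (W L) Wm Wp in
  let Phi := fun eps eta : R =>
    macro_flux eps eta dt sigma n (f K) (f L) We dWm dWp in
  let drho := (rho (W L) - rho (W K)) / h - kappa * ((rho Wp - rho Wm) / len) in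
  let dq := (q (W L) - q (W K)) / h - kappa * ((q Wp - q Wm) / len) in
  [/\ 2^-1 *: (dWm + dWp)
        = h^-1 *: (W L - W K) - (kappa / len) *: (Wp - Wm),
      Phi eps eps 0 0 @[eps --> 0^'+] --> - (2 / (3 * sigma)) * dq
    & Phi eps eps 1 0 @[eps --> 0^'+] -->
        - (2 / (3 * sigma)) * (5 * q We ^+ 2 / (3 * rho We)) *
          (- (rho We)^-1 * drho + 2 / q We * dq)].
Proof.
move=> xK xL h hm hp kappa len sigma We dWm dWp Phi drho dq.
have [hm0 hp0] : 0 < hm /\ 0 < hp.
  exact: edge_distances_gt0 e_KL n_normal xs_e.
have hE : h = hm + hp by rewrite /h /hm /hp !dotBl; ring.
have [KT LT _ _ _] := e_KL.
have [[rK qK] [rL qL]] := (W_gt0 _ KT, W_gt0 _ LT).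
have re : 0 < rho We by rewrite /rho /We hE; exact: interface_state_gt0.
have qe : 0 < q We by rewrite /q /We hE; exact: interface_state_gt0.
have sigma0 : 0 < sigma by rewrite divr_gt0 // addr_gt0 // opacity_gt0.
have consistency : 2^-1 *: (dWm + dWp) =
    h^-1 *: (W L - W K) - (kappa / len) *: (Wp - Wm).
  by rewrite /dWm /dWp /We hE; exact: mean_half_slope.
have slopes i : dWm i 0 + dWp i 0 = 2 * ((W L i 0 - W K i 0) / h
    - kappa * ((Wp i 0 - Wm i 0) / len)).
  have /colP/(_ i) := consistency; rewrite !mxE => E.
  by rewrite -[LHS](mulVKf (_ : 2 != 0)) // E; ring.
have n1 : enorm n = 1 by case: n_normal.
(* I d / (2 pi) is the radial moment; with the factor 2 pi / 3 of a half sphere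
   and the limit - 1 / sigma of D, this leaves - 1 / (3 sigma). *)
have lim i (I : 'cV[R]_2 -> R) : (forall d,
    lebesgue_measure.-integrable `[0, +oo[
      (EFin \o (fun v => v ^+ 4 * (Psi v i 0 * maxwellian_slope We d v))) /\
    \int[lebesgue_measure]_(v in `[0, +oo[)
      (v ^+ 4 * (Psi v i 0 * maxwellian_slope We d v)) = I d / (2 * pi)) ->
    Phi eps eps i 0 @[eps --> 0^'+] --> - (3 * sigma)^-1 * (I dWm + I dWp).
  move=> hI; have [S SE] := macro_fluxE dt sigma n (f K) (f L) We dWm dWp i
    n1 re qe (fK_moments i) (fL_moments i) (fun d => (hI d).1).
  under eq_fun do rewrite /Phi SE !(hI _).2.
  have -> : - (3 * sigma)^-1 * (I dWm + I dWp) = 0 * S +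
      - sigma^-1 * (2 * pi / 3 * (I dWm / (2 * pi) + I dWp / (2 * pi))).
    by move: (@pi R) (pi_gt0 R) => p p0; field; rewrite !gt_eqF.
  apply: cvgD; apply: cvgM; try exact: cvg_cst.
    exact: cvg_coefA.
  exact: cvg_coefD.
have drhoE : rho dWm + rho dWp = 2 * drho by exact: slopes.
have dqE : q dWm + q dWp = 2 * dq by exact: slopes.
split=> //.
- have -> : - (2 / (3 * sigma)) * dq = - (3 * sigma)^-1 * (q dWm + q dWp).
    by rewrite dqE; field; rewrite gt_eqF.
  by apply: (lim 0 (fun d => q d)) => d; exact: slope_moment_rho.
- pose I d : R := 5 * q We ^+ 2 / (3 * rho We) *
    (- (rho We)^-1 * rho d + 2 / q We * q d).
  have -> : - (2 / (3 * sigma)) * (5 * q We ^+ 2 / (3 * rho We)) *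
      (- (rho We)^-1 * drho + 2 / q We * dq)
      = - (3 * sigma)^-1 * (I dWm + I dWp).
    transitivity (- (3 * sigma)^-1 * (5 * q We ^+ 2 / (3 * rho We) *
       (- (rho We)^-1 * (rho dWm + rho dWp) + 2 / q We * (q dWm + q dWp)))).
      by rewrite drhoE dqE; field; rewrite !gt_eqF.
    by rewrite /I; field; rewrite !gt_eqF.
  by apply: (lim 1 I) => d; exact: slope_moment_q.
Qed.
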